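(* Let $f=\sum_{1\le i\le j\le n}a_{ij}X_iX_j$, with all $a_{ij}\in\mathbb{Z}$, be a positive definite integral quadratic form. If $f$ is almost primitively universal, then for every prime $p$, $f$ non-trivially represents zero over $\mathbb{Z}_p$, i.e. there exist $x_1,\ldots,x_n\in\mathbb{Z}_p$, not all zero, with $f(x_1,\ldots,x_n)=0$.
   Context: A positive definite integral quadratic form $f$ in $n$ variables is almost primitively universal if for all sufficiently large positive integers $a$ there exist $x_1,\ldots,x_n\in\mathbb{Z}$ with $\gcd(x_1,\ldots,x_n)=1$ and $f(x_1,\ldots,x_n)=a$ (i.e. only finitely many positive integers fail to be primitively represented). $\mathbb{Z}_p$ denotes the ring of $p$-adic integers. No condition is imposed on the parity of the cross-term coefficients $a_{ij}$, $i\neq j$. *)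

(* Defs.v *)
From HB Require Import structures.
From mathcomp Require Import all_boot all_order all_algebra.
From mathcomp Require Import boolp reals.

Set Implicit Arguments.
Unset Strict Implicit.
Unset Printing Implicit Defensive.

Import Order.TTheory GRing.Theory Num.Theory.

Local Open Scope ring_scope.

(* The p-adic integers as the inverse limit of the rings Z / p^k: the class   *)
(* in Z / p^k is given by its remainder, [padic_res x k], and the coherence   *)
(* condition also forces [0 <= padic_res x k < p ^ k] when p > 0.             *)
Record padic_int (p : nat) := PadicInt {
  padic_res : nat -> int;
  padic_resP : forall k, padic_res k = (padic_res k.+1 %% (p ^ k)%N)%Z
}.

Section PadicRing.
Variable p : nat.
Implicit Types x y z : padic_int p.

HB.instance Definition _ := gen_eqMixin (padic_int p).
HB.instance Definition _ := gen_choiceMixin (padic_int p).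

Lemma padic_int_inj x y : padic_res x =1 padic_res y -> x = y.
Proof.
case: x y => [u uP] [v vP] /= /funext euv; rewrite euv in uP *.
by rewrite (Prop_irrelevance uP vP).
Qed.

Lemma modz_expS (m : int) k :
  ((m %% (p ^ k.+1)%N)%Z = m %[mod (p ^ k)%N])%Z.
Proof.
rewrite [in RHS](divz_eq m (p ^ k.+1)%N) expnS PoszM mulrA.
by rewrite modzMDl.
Qed.

Lemma padic_res_mod x k : (padic_res x k %% (p ^ k)%N)%Z = padic_res x k.
Proof. by rewrite padic_resP modz_mod. Qed.

Lemma padic_of_seq_subproof (u : nat -> int) :
    (forall k, u k.+1 = u k %[mod (p ^ k)%N])%Z ->
  forall k, (u k %% (p ^ k)%N)%Z = ((u k.+1 %% (p ^ k.+1)%N)%Z %% (p ^ k)%N)%Z.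
Proof. by move=> uP k; rewrite modz_expS uP. Qed.

Definition padic_of_seq u uP :=
  PadicInt (@padic_of_seq_subproof u uP).

Lemma padic_resS x k : (padic_res x k.+1 = padic_res x k %[mod (p ^ k)%N])%Z.
Proof. by rewrite -padic_resP padic_res_mod. Qed.

Lemma padic_cst_subproof (m : int) k : (m = m %[mod (p ^ k)%N])%Z.
Proof. by []. Qed.

Lemma padic_opp_subproof x k :
  (- padic_res x k.+1 = - padic_res x k %[mod (p ^ k)%N])%Z.
Proof. by rewrite -modzNm padic_resS modzNm. Qed.

Lemma padic_add_subproof x y k :
  (padic_res x k.+1 + padic_res y k.+1
   = padic_res x k + padic_res y k %[mod (p ^ k)%N])%Z.
Proof. by rewrite -modzDm !padic_resS modzDm. Qed.

Lemma padic_mul_subproof x y k :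
  (padic_res x k.+1 * padic_res y k.+1
   = padic_res x k * padic_res y k %[mod (p ^ k)%N])%Z.
Proof. by rewrite -modzMm !padic_resS modzMm. Qed.

Definition padic_zero := padic_of_seq (padic_cst_subproof 0).
Definition padic_one := padic_of_seq (padic_cst_subproof 1).
Definition padic_opp x := padic_of_seq (padic_opp_subproof x).
Definition padic_add x y := padic_of_seq (padic_add_subproof x y).
Definition padic_mul x y := padic_of_seq (padic_mul_subproof x y).

Lemma padic_addA : associative padic_add.
Proof.
by move=> x y z; apply: padic_int_inj => k /=; rewrite modzDmr modzDml addrA.
Qed.

Lemma padic_addC : commutative padic_add.
Proof.
by move=> x y; apply: padic_int_inj => k /=; rewrite addrC.
Qed.

Lemma padic_add0 : left_id padic_zero padic_add.
Proof.
by move=> x; apply: padic_int_inj => k /=; rewrite modzDml add0r padic_res_mod.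
Qed.

Lemma padic_addN : left_inverse padic_zero padic_opp padic_add.
Proof.
by move=> x; apply: padic_int_inj => k /=; rewrite modzDml addNr.
Qed.

HB.instance Definition _ := GRing.isZmodule.Build (padic_int p)
  padic_addA padic_addC padic_add0 padic_addN.

Lemma padic_mulA : associative padic_mul.
Proof.
by move=> x y z; apply: padic_int_inj => k /=; rewrite modzMmr modzMml mulrA.
Qed.

Lemma padic_mulC : commutative padic_mul.
Proof.
by move=> x y; apply: padic_int_inj => k /=; rewrite mulrC.
Qed.

Lemma padic_mul1 : left_id padic_one padic_mul.
Proof.
by move=> x; apply: padic_int_inj => k /=; rewrite modzMml mul1r padic_res_mod.
Qed.

Lemma padic_mulD : left_distributive padic_mul padic_add.
Proof.
by move=> x y z; apply: padic_int_inj => k /=; rewrite modzMml modzDm mulrDl.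
Qed.

HB.instance Definition _ := GRing.Zmodule_isComPzRing.Build (padic_int p)
  padic_mulA padic_mulC padic_mul1 padic_mulD.

End PadicRing.

(* Only the entries [a i j] with [i <= j] matter: [a i j] is the coefficient  *)
(* of X_i X_j, so the cross terms are not doubled.                            *)
Definition qform (n : nat) (a : 'M[int]_n) (R : comPzRingType)
    (x : 'rV[R]_n) : R :=
  \sum_(i < n) \sum_(j < n | (i <= j)%N) (a i j)%:~R * x 0 i * x 0 j.

Definition positive_definite (R : realType) (n : nat) (a : 'M[int]_n) : Prop :=
  forall x : 'rV[R]_n, x != 0 -> 0 < qform a x.

Definition primitive (n : nat) (x : 'rV[int]_n) : Prop :=
  \big[gcdn/0%N]_(i < n) `|x ord0 i|%N = 1%N.

Definition almost_primitively_universal (n : nat) (a : 'M[int]_n) : Prop :=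
  exists N : nat, forall m : nat, (N < m)%N ->
    exists x : 'rV[int]_n, primitive x /\ qform a x = m%:Z.

Definition isotropic_over_padic_int (n : nat) (a : 'M[int]_n) (p : nat) :=
  exists x : 'rV[padic_int p]_n, x != 0 /\ qform a x = 0.

(* Main.v *)
Require Import Defs.
From mathcomp Require Import all_boot all_order all_algebra.
From mathcomp Require Import boolp reals.

(** Represent primitively the large powers of [p], say [f (X m) = p ^ (N + m)].
    Since [Z_p ^ n] is compact, some subsequence of [X] converges to a vector
    [y] over [Z_p]; then [f y = 0] because [p ^ m] tends to [0], and [y] is
    nonzero because it is congruent modulo [p] to a primitive vector. *)

Set Implicit Arguments.
Unset Strict Implicit.
Unset Printing Implicit Defensive.

Import Order.TTheory GRing.Theory Num.Theory.

Local Open Scope ring_scope.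

Definition infinitely_often (A : nat -> Prop) : Prop :=
  forall N : nat, exists m : nat, (N <= m)%N /\ A m.

(** Otherwise each colour [t] stops occurring on [A] from some bound [b t] on, and an element of [A]
    beyond all these bounds has no colour left. *)
Lemma infinite_pigeonhole (T : finType) (A : nat -> Prop) (c : nat -> T) :
  infinitely_often A ->
  exists t : T, infinitely_often (fun m => A m /\ c m = t).
Proof.
move=> infA; apply: contrapT => /forallNP nP.
have /choice[b bP] : forall t, exists b : nat,
    forall m, (b <= m)%N -> ~ (A m /\ c m = t).
  move=> t; apply: contrapT => /forallNP bP; apply: (nP t) => N.
  by have /existsNP[m /not_implyP[mN /contrapT Am]] := bP N; exists m.
have [m [mN Am]] := infA (\max_t b t).
by apply: (bP (c m) m) => //; apply: leq_trans mN; apply: leq_bigmax.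
Qed.

Lemma dependent_choice (T : nat -> Type) (t0 : T 0%N)
    (S : forall k, T k -> T k.+1 -> Prop) :
  (forall k t, exists t', S k t t') ->
  exists f : forall k, T k, forall k, S k (f k) (f k.+1).
Proof.
move=> SP.
pose next k t : T k.+1 := projT1 (cid (SP k t)).
pose fix f k : T k := if k is k'.+1 then next k' (f k') else t0.
by exists f => k /=; exact: projT2 (cid (SP k (f k))).
Qed.

Definition row_eqmod (n : nat) (d : int) (v w : 'rV[int]_n) : Prop :=
  forall i, (v 0%R i = w 0%R i %[mod d])%Z.

(** Congruence modulo [p ^ k] between a p-adic and an ordinary integer; [m] need not be reduced, so
    the relation passes directly through ring operations. *)
Definition padic_congr (p k : nat) (x : padic_int p) (m : int) : Prop :=
  padic_res x k = (m %% (p ^ k)%N)%Z.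

Section PadicCongr.
Variables p k : nat.
Implicit Types (x y : padic_int p) (m l : int).

Lemma padic_congr0 : padic_congr k (0 : padic_int p) 0.
Proof. by []. Qed.

Lemma padic_congr1 : padic_congr k (1 : padic_int p) 1.
Proof. by []. Qed.

Lemma padic_congrD x y m l :
  padic_congr k x m -> padic_congr k y l -> padic_congr k (x + y) (m + l).
Proof. by rewrite /padic_congr /= => -> ->; rewrite modzDm. Qed.

Lemma padic_congrN x m : padic_congr k x m -> padic_congr k (- x) (- m).
Proof. by rewrite /padic_congr /= => ->; rewrite modzNm. Qed.

Lemma padic_congrM x y m l :
  padic_congr k x m -> padic_congr k y l -> padic_congr k (x * y) (m * l).
Proof. by rewrite /padic_congr /= => -> ->; rewrite modzMm. Qed.

Lemma padic_congr_int m : padic_congr k (m%:~R : padic_int p) m.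
Proof.
elim/int_rect: m => [|m IHm|m IHm]; first exact: padic_congr0.
- by rewrite -addn1 PoszD intrD; apply: padic_congrD IHm padic_congr1.
- rewrite -addn1 PoszD opprD intrD; apply: padic_congrD IHm _.
  by rewrite mulrN1z; apply: padic_congrN padic_congr1.
Qed.

(** A form with integer coefficients is built from ring operations, all of which respect congruence
    modulo [p ^ k]. *)
Lemma padic_congr_qform n (a : 'M[int]_n) (y : 'rV[padic_int p]_n)
    (v : 'rV[int]_n) :
  (forall i, padic_congr k (y 0 i) (v 0 i)) ->
  padic_congr k (qform a y) (qform a v).
Proof.
move=> yv; apply: (big_ind2 (@padic_congr p k)) => [|x m z l|i _].
- exact: padic_congr0.
- exact: padic_congrD.
apply: (big_ind2 (@padic_congr p k)) => [|x m z l|j _].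
- exact: padic_congr0.
- exact: padic_congrD.
apply: padic_congrM (yv j); apply: padic_congrM (yv i).
(* Over [int] the coefficient [(a i j)%:~R] is [a i j] itself. *)
by rewrite intz; apply: padic_congr_int.
Qed.

End PadicCongr.

Section Compactness.
Variables (p n : nat) (p_gt0 : (0 < p)%N) (X : nat -> 'rV[int]_n).

Definition cluster_mod (k : nat) (v : 'rV[int]_n) : Prop :=
  infinitely_often (fun m => row_eqmod (p ^ k)%N v (X m)).

(** The class of [v] modulo [p ^ k] splits into finitely many classes modulo [p ^ k.+1], so one of
    them contains [X m] for infinitely many [m]. *)
Lemma cluster_mod_lift k v : cluster_mod k v ->
  exists2 w, cluster_mod k.+1 w & row_eqmod (p ^ k)%N w v.
Proof.
set q := (p ^ k.+1)%N; have q_gt0 : (0 < q)%N by rewrite expn_gt0 p_gt0.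
(* The colour of [m] is the residue vector of [X m] modulo [q]; the bound [q.-1.+1] equals [q] and
   has the successor shape that [inord] needs. *)
pose c m : {ffun 'I_n -> 'I_q.-1.+1} :=
  [ffun i => inord `|(X m 0%R i %% q)%Z|%N].
have cE m i : (c m i)%:Z = (X m 0%R i %% q)%Z.
  have r_ge0 : 0 <= (X m 0%R i %% q)%Z by rewrite modz_ge0 // eqz_nat -lt0n.
  rewrite ffunE inordK ?prednK //; first by rewrite gez0_abs.
  by rewrite -ltz_nat gez0_abs // ltz_pmod.
move=> /(infinite_pigeonhole c)[t tP].
pose w : 'rV[int]_n := \row_i (t i)%:Z.
have wX m : c m = t -> row_eqmod q w (X m).
  by move=> cmt i; rewrite mxE -cmt cE modz_mod.
exists w; first by move=> N; have [m [mN [_ /wX]]] := tP N; exists m.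
(* Any single [X m] lying in both classes links [w] to [v]. *)
have [m [_ [vX /wX wXm]]] := tP 0%N.
by move=> i; rewrite vX -modz_expS wXm modz_expS.
Qed.

(** Repeated lifting gives a coherent chain of cluster classes, whose limit is [y]. Approximation at
    every level [k] replaces an explicit subsequence. *)
Lemma padic_cluster_point :
  exists y : 'rV[padic_int p]_n, forall k,
    infinitely_often (fun m => forall i, padic_congr k (y 0 i) (X m 0 i)).
Proof.
have cl0 : cluster_mod 0 0.
  by move=> N; exists N; split=> // i; rewrite expn0 !modz1.
have [|V VP] := @dependent_choice (fun k => {v | cluster_mod k v})
    (exist _ 0 cl0) (fun k v w => row_eqmod (p ^ k)%N (sval w) (sval v)).
  move=> k [v cl_v]; have [w cl_w wv] := cluster_mod_lift cl_v.
  by exists (exist _ w cl_w).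
(* The link [VP k] between consecutive classes is exactly the coherence required of a p-adic
   integer, coordinate by coordinate. *)
pose u i := padic_of_seq (fun k => VP k i).
exists (\row_i u i) => k N.
have [m [mN Vm]] := svalP (V k) N.
by exists m; split=> // i; rewrite mxE; apply: Vm.
Qed.

End Compactness.

(** A common divisor of all coordinates would divide their gcd, which is 1. *)
Lemma primitive_ndvd n (x : 'rV[int]_n) (d : nat) :
  primitive x -> (1 < d)%N -> exists i, ~~ (d %| `|x 0%R i|)%N.
Proof.
move=> x_prim d_gt1; apply/existsP; rewrite -negb_forall.
apply: contraL d_gt1 => /forallP dx.
suff: (d %| 1)%N by rewrite dvdn1 => /eqP->.
by rewrite -x_prim; apply: (big_ind (dvdn d)) => [|u v du dv|//];
  rewrite ?dvdn0 // dvdn_gcd du.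
Qed.

Theorem theorem1p1 (R : realType) (n : nat) (a : 'M[int]_n)
    (a_posdef : positive_definite R a)
    (a_apu : almost_primitively_universal a) (p : nat) (p_prime : prime p) :
  isotropic_over_padic_int a p.
Proof.
have [N NP] := a_apu; have p_gt1 := prime_gt1 p_prime.
have /choice[X XP] : forall m, exists x : 'rV[int]_n,
    primitive x /\ qform a x = (p ^ (N + m))%N%:Z.
  move=> m; apply: NP.
  (* The exponent is shifted by [N] because [N <= N + m < p ^ (N + m)]. *)
  by apply: leq_ltn_trans (ltn_expl _ p_gt1); apply: leq_addr.
have [y yX] := padic_cluster_point (prime_gt0 p_prime) X.
exists y; split.
  apply/eqP => y0; have [m [_ yXm]] := yX 1%N 0%N.
  have [i /negP[]] := primitive_ndvd (XP m).1 p_gt1.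
  have := yXm i; rewrite y0 mxE /padic_congr /= mod0z expn1 => Xi0.
  by rewrite -[p]/`|p%:Z|%N -dvdzE; apply/dvdz_mod0P.
(* At level [k], an index [m >= k] makes [p ^ k] divide the value [p ^ (N + m)]. *)
apply: padic_int_inj => k; have [m [km yXm]] := yX k k.
rewrite (padic_congr_qform a yXm) (XP m).2 /= mod0z.
apply/dvdz_mod0P; rewrite dvdzE /= dvdn_exp2l //.
exact: leq_trans km (leq_addl _ _).
Qed.
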